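(* Let $p$ be a prime with $p\equiv 1 \pmod 4$, and let $r$ be a positive integer. Let $A,B\subset(\mathbb{Z}/p^r\mathbb{Z})^2$ and put $\delta_A=|A|/p^{2r}$, $\delta_B=|B|/p^{2r}$. Suppose that $\delta_A\cdot\delta_B\ge 2p^{-1}$. Then for a positive proportion of $g\in SO_2(\mathbb{Z}/p^r\mathbb{Z})$ we have $|gA-B|\gg p^{2r}$; that is, there are absolute constants $c,c'>0$ (independent of $p,r,A,B$) such that \[\#\{g\in SO_2(\mathbb{Z}/p^r\mathbb{Z}) : |gA-B|\ge c\,p^{2r}\}\ge c'\,|SO_2(\mathbb{Z}/p^r\mathbb{Z})|.\]
   Context: $SO_2(\mathbb{Z}/p^r\mathbb{Z})$ is the group of matrices $\begin{bmatrix}a&-b\\ b&a\end{bmatrix}$ with $a,b\in\mathbb{Z}/p^r\mathbb{Z}$ and $a^2+b^2\equiv 1\pmod{p^r}$, acting on $(\mathbb{Z}/p^r\mathbb{Z})^2$ by matrix multiplication. For $g$ in this group, $gA-B=\{g\mathbf{a}-\mathbf{b}:\mathbf{a}\in A,\mathbf{b}\in B\}$. The notation $X\gg Y$ means $X\ge CY$ for an absolute constant $C>0$. *)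

(* Defs.v *)
From mathcomp Require Export all_boot all_order all_algebra.
From mathcomp Require Export reals.

Set Implicit Arguments.
Unset Strict Implicit.
Unset Printing Implicit Defensive.

Import GRing.Theory Num.Theory.
Local Open Scope ring_scope.

(* The matrix [a, -b; b, a]. *)
Definition rotmx (S : nzRingType) (a b : S) : 'M[S]_2 :=
  \matrix_(i < 2, j < 2)
    (if i == j then a else if (i < j)%N then - b else b).

(* 'Z_n is Z/nZ only for n > 1. *)
Definition SO2 (n : nat) : {set 'M['Z_n]_2} :=
  [set rotmx x.1 x.2 | x : 'Z_n * 'Z_n & x.1 ^+ 2 + x.2 ^+ 2 == 1].

Definition rotdiff (n : nat) (g : 'M['Z_n]_2) (A B : {set 'cV['Z_n]_2}) :
  {set 'cV['Z_n]_2} := [set g *m a - b | a in A, b in B].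

Definition density (R : realType) (n : nat) (A : {set 'cV['Z_n]_2}) : R :=
  #|A|%:R / n%:R ^+ 2.

(* Main.v *)
(** Write q = p^r and let E(g) count the quadruples with g a - b = g a' - b'.
By Cauchy-Schwarz (|A| |B|)^2 <= |gA - B| E(g), so it suffices to show that the
average of E(g) is at most 2 (|A| |B|)^2 / q^2: by Markov's inequality half of
the g then satisfy |gA - B| >= q^2 / 4.  By Fourier analysis q^2 E(g) is the sum
over the frequencies xi of |B^(xi)|^2 |A^(xi g)|^2.  The term xi = 0 is
(|A| |B|)^2.  For xi <> 0, every fibre of g |-> xi g has at most |SO_2| / (p - 1)
elements, so Plancherel bounds the sum over g of the remaining terms by
|SO_2| q^4 |A| |B| / (p - 1), which the density hypothesis makes at most
|SO_2| (|A| |B|)^2. *)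
Require Import Defs.
From mathcomp Require Import all_solvable all_field.
From mathcomp Require Import ring zify.
Import Order.TTheory GRing.Theory Num.Theory.
Local Open Scope ring_scope.

Set Implicit Arguments.
Unset Strict Implicit.
Unset Printing Implicit Defensive.

(** * Cauchy-Schwarz for collision counts *)

Lemma card_sqr_le_collisions (I T : finType) (D : {set I}) (f : I -> T) :
  (#|D| ^ 2 <= #|f @: D| *
     #|[set u : I * I | [&& u.1 \in D, u.2 \in D & f u.1 == f u.2]]|)%N.
Proof.
pose nu z := #|[set i in D | f i == z]|.
have cD : #|D| = (\sum_(z in f @: D) nu z)%N.
  rewrite -sum1_card (partition_big f (mem (f @: D))) /=; last first.
    by move=> i iD; apply: imset_f.
  apply: eq_bigr => z _; rewrite /nu -sum1_card; apply: eq_bigl => i.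
  by rewrite inE.
have cE : #|[set u : I * I | [&& u.1 \in D, u.2 \in D & f u.1 == f u.2]]|
    = (\sum_(z in f @: D) nu z ^ 2)%N.
  rewrite -sum1_card (partition_big (fun u => f u.1) (mem (f @: D))) /=; last first.
    by move=> u; rewrite inE => /and3P[? _ _]; apply: imset_f.
  apply: eq_bigr => z _; rewrite -mulnn /nu -cardsX -sum1_card.
  apply: eq_bigl => -[i j]; rewrite !inE /=.
  case: (i \in D); case: (j \in D) => //=; last by rewrite andbF.
  by rewrite andbC; case: (f i =P z) => //= ->; rewrite eq_sym.
(* Doubling both sides reduces the claim to [2 x y <= x ^ 2 + y ^ 2] for each pair of fibre sizes
   [nu]. *)
rewrite cE -(leq_pmul2l (isT : (0 < 2)%N)) -mulnn {1 2}cD.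
rewrite big_distrlr /= big_distrr /=.
have -> : (2 * (#|f @: D| * \sum_(z in f @: D) nu z ^ 2))%N
   = (\sum_(z in f @: D) \sum_(y in f @: D) (nu z ^ 2 + nu y ^ 2))%N.
  under [RHS]eq_bigr do rewrite big_split /= sum_nat_const.
  by rewrite big_split /= sum_nat_const -big_distrr /= mul2n addnn.
apply: leq_sum => z _; rewrite big_distrr /=; apply: leq_sum => y _.
exact: nat_Cauchy.
Qed.

(** * Fourier analysis on column vectors over Z/nZ *)

Section Fourier.

Variables (n m : nat) (z : algC).
Hypotheses (n_gt1 : (1 < n)%N) (z_prim : n.-primitive_root z).

Definition addchar (x : 'Z_n) : algC := z ^+ x.

Lemma addcharD x y : addchar (x + y) = addchar x * addchar y.
Proof.
rewrite /addchar /= -exprD -(prim_expr_mod z_prim (x + y)).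
(* Addition in ['Z_n] reduces modulo [(Zp_trunc n).+2], which is [n] because [1 < n]. *)
by congr (_ ^+ (_ %% _)); apply: Zp_cast.
Qed.

Lemma addchar0 : addchar 0 = 1.
Proof. by []. Qed.

Lemma addchar_eq1 x : (addchar x == 1) = (x == 0).
Proof.
rewrite /addchar -(prim_order_dvd z_prim); apply/idP/eqP => [|-> //].
move=> dvd_nx; apply: val_inj => /=; apply/eqP; rewrite -leqn0 leqNgt.
apply/negP => x_gt0; have := dvdn_leq x_gt0 dvd_nx.
by have := ltn_ord x; rewrite [X in (_ < X)%N]Zp_cast // ltnNge => /negPf->.
Qed.

Lemma norm_addchar x : `|addchar x| = 1.
Proof.
apply/eqP; rewrite -(@pexpr_eq1 _ _ n) ?normr_ge0 ?prim_order_gt0 //; last exact: ltnW.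
by rewrite -normrX /addchar exprAC (prim_expr_order z_prim) expr1n normr1.
Qed.

Lemma addcharN x : addchar (- x) = (addchar x)^*.
Proof.
have cx : addchar x * (addchar x)^* = 1 by rewrite -normCK norm_addchar expr1n.
have: addchar x * addchar (- x) = 1 by rewrite -addcharD subrr.
rewrite -cx; apply: mulfI; rewrite -normr_eq0 norm_addchar; exact: oner_neq0.
Qed.

(** Frequencies are rows, so a matrix acting on [x] from the left passes to [xi] from the right by
    associativity. *)
Definition vchar (xi : 'rV['Z_n]_m) (x : 'cV['Z_n]_m) : algC :=
  addchar ((xi *m x) 0 0).

Lemma vcharDr xi x y : vchar xi (x + y) = vchar xi x * vchar xi y.
Proof. by rewrite /vchar mulmxDr mxE addcharD. Qed.

Lemma vcharNr xi x : vchar xi (- x) = (vchar xi x)^*.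
Proof. by rewrite /vchar mulmxN mxE addcharN. Qed.

Lemma vcharDl xi eta x : vchar (xi + eta) x = vchar xi x * vchar eta x.
Proof. by rewrite /vchar mulmxDl mxE addcharD. Qed.

(** Shifting the summation variable by [eta] multiplies the sum by [vchar eta x]. For nonzero [x]
    some basis row [eta] makes this factor differ from 1, so the sum vanishes. *)
Lemma sum_vchar x :
  \sum_xi vchar xi x = (if x == 0 then (n ^ m)%N else 0%N)%:R.
Proof.
case: (eqVneq x 0) => [->|x_neq0].
  under eq_bigr do rewrite /vchar mulmx0 mxE addchar0.
  by rewrite sumr_const card_mx card_ord mul1n Zp_cast.
have [eta eta1] : exists eta, vchar eta x != 1.
  have /existsP[i xi] : [exists i, x i 0 != 0].
    apply: contraNT x_neq0; rewrite negb_exists => /forallP x0.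
    apply/eqP/matrixP => i j; rewrite mxE ord1.
    by apply/eqP; rewrite -[_ == _]negbK x0.
  exists (delta_mx 0 i); rewrite /vchar addchar_eq1 -rowE mxE; exact: xi.
set S := \sum_xi _.
have eS : S = vchar eta x * S.
  rewrite {1}/S (reindex_inj (addrI eta)) /= big_distrr /=.
  by apply: eq_bigr => xi _; rewrite vcharDl.
apply/eqP; move/eqP: eS; rewrite -subr_eq0 -{1}[S]mul1r -mulrBl mulf_eq0.
by rewrite subr_eq0 eq_sym (negPf eta1).
Qed.

(* Plancherel for the image measure of D under f. *)
Lemma sum_norm_sqr_vchar (I : finType) (D : {set I}) (f : I -> 'cV['Z_n]_m) :
  \sum_xi `|\sum_(i in D) vchar xi (f i)| ^+ 2 =
  (n ^ m * #|[set u : I * I | [&& u.1 \in D, u.2 \in D & f u.1 == f u.2]]|)%N%:R.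
Proof.
under eq_bigr => xi _.
  rewrite normCK rmorph_sum /= big_distrlr /=.
  under eq_bigr do under eq_bigr do rewrite -vcharNr -vcharDr.
  over.
rewrite exchange_big /=; under eq_bigr do rewrite exchange_big /=.
under eq_bigr do under eq_bigr do rewrite sum_vchar subr_eq0.
rewrite pair_big /= -natr_sum; congr (_%:R).
rewrite -big_mkcondr sum_nat_const mulnC; congr (_ * _)%N.
by rewrite cardsE; apply: eq_card => -[i j]; rewrite -!topredE /= andbA.
Qed.

Definition spectrum (A : {set 'cV['Z_n]_m}) (xi : 'rV['Z_n]_m) : algC :=
  `|\sum_(a in A) vchar xi a| ^+ 2.

Lemma spectrum_ge0 A xi : 0 <= spectrum A xi.
Proof. by rewrite exprn_ge0. Qed.

Lemma spectrum0 A : spectrum A 0 = (#|A| ^ 2)%N%:R.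
Proof.
rewrite /spectrum; under eq_bigr do rewrite /vchar mul0mx mxE addchar0.
by rewrite sumr_const normr_nat -natrX.
Qed.

Lemma sum_spectrum A : \sum_xi spectrum A xi = (n ^ m * #|A|)%N%:R.
Proof.
rewrite (sum_norm_sqr_vchar A id); congr (_ * _)%N%:R.
rewrite -(card_imset (mem A) (f := fun x => (x, x))); last by move=> x y [].
apply: eq_card => -[x y]; rewrite !inE /=; apply/and3P/imsetP => /=.
  by case=> xA yA /eqP<-; exists x.
by case=> a aA [-> ->]; rewrite !aA eqxx.
Qed.

Definition collisions (g : 'M['Z_n]_m) (A B : {set 'cV['Z_n]_m}) :=
  [set u : ('cV['Z_n]_m * 'cV['Z_n]_m) * ('cV['Z_n]_m * 'cV['Z_n]_m) |
    [&& u.1 \in setX A B, u.2 \in setX A B &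
        g *m u.1.1 - u.1.2 == g *m u.2.1 - u.2.2]].

(** Plancherel for [(a, b) |-> g a - b] on the product set: the transform factors, and conjugating
    the [B] factor keeps its norm. *)
Lemma card_collisions g A B :
  (n ^ m * #|collisions g A B|)%N%:R
    = \sum_xi spectrum B xi * spectrum A (xi *m g).
Proof.
rewrite -(sum_norm_sqr_vchar (setX A B) (fun u => g *m u.1 - u.2)).
apply: eq_bigr => xi _; rewrite -exprMn; congr (_ ^+ 2).
rewrite -(norm_conjC (\sum_(a in B) _)) rmorph_sum -normrM mulrC big_distrlr /=.
rewrite pair_big; congr `|_|.
apply: eq_big => [u|[a b] _] /=; first by rewrite inE.
by rewrite vcharDr vcharNr /vchar mulmxA.
Qed.

(* The frequency xi = 0 contributes the expected number of collisions; a
   nonzero frequency is spread over large orbits, so Plancherel bounds it. *)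
Lemma sum_collisions_le (G : {set 'M['Z_n]_m}) (k : nat) (A B : {set 'cV['Z_n]_m}) :
  (forall xi eta : 'rV['Z_n]_m, xi != 0 ->
     (#|[set g in G | xi *m g == eta]| * k <= #|G|)%N) ->
  (k * (n ^ m * \sum_(g in G) #|collisions g A B|) <=
     k * (#|G| * (#|A| * #|B|) ^ 2) + #|G| * ((n ^ m) ^ 2 * (#|A| * #|B|)))%N.
Proof.
move=> fibre_le; rewrite -(ler_nat algC).
rewrite big_distrr natrM natr_sum.
under eq_bigr do rewrite card_collisions.
rewrite exchange_big /=; under eq_bigr do rewrite -big_distrr /=.
rewrite (bigD1 0) //= mulrDr natrD; apply: lerD.
  under eq_bigr do rewrite mul0mx.
  rewrite sumr_const !spectrum0 -mulrnA -!natrM ler_nat.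
  by rewrite expnMn; apply: eq_leq; ring.
have le_xi (xi : 'rV['Z_n]_m) : xi != 0 ->
    k%:R * (\sum_(g in G) spectrum A (xi *m g)) <= #|G|%:R * (n ^ m * #|A|)%N%:R.
  (* Each [spectrum A eta] is counted once per [g] with [xi *m g = eta], hence at most [#|G|] times
     after multiplying by [k]. *)
  move=> xi0; rewrite (partition_big (fun g => xi *m g) predT) //=.
  rewrite -sum_spectrum !big_distrr /=; apply: ler_sum => eta _.
  rewrite (eq_bigr (fun=> spectrum A eta)); last by move=> g /andP[_ /eqP->].
  rewrite sumr_const mulrnAr -mulrnAl -mulrnA ler_wpM2r ?spectrum_ge0 // ler_nat.
  rewrite mulnC; apply: leq_trans (fibre_le xi eta xi0).
  by rewrite cardsE.
rewrite big_distrr /=.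
apply: (@le_trans _ _ (\sum_(xi | xi != 0)
    spectrum B xi * (#|G|%:R * (n ^ m * #|A|)%N%:R))).
  apply: ler_sum => xi xi0; rewrite mulrCA ler_wpM2l ?spectrum_ge0 //.
  exact: le_xi.
rewrite -big_distrl /=.
have: \sum_(xi | xi != 0) spectrum B xi <= (n ^ m * #|B|)%N%:R.
  by rewrite -sum_spectrum [leRHS](bigD1 0) //= lerDr spectrum_ge0.
move=> leB; apply: le_trans (ler_wpM2r _ leB) _; first by rewrite -natrM ler0n.
by rewrite -!natrM ler_nat; apply: eq_leq; ring.
Qed.

End Fourier.

(** * Square roots of -1 modulo p^r *)

Lemma exists_sqr_eqN1_mod_prime p : prime p -> p = 1 %[mod 4] ->
  exists x, (p %| x ^ 2 + 1)%N.
Proof.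
move=> p_pr p1; have p_gt1 := prime_gt1 p_pr.
have dvd4 : (4 %| p.-1)%N by rewrite -subn1 -eqn_mod_dvd ?prime_gt0 // p1.
have p1_gt0 : (0 < p.-1)%N by rewrite -ltnS prednK ?prime_gt0.
have /hasP[w _ w_prim] : has p.-1.-primitive_root (enum (predC1 (0 : 'F_p))).
  apply: has_prim_root => //; last 1 first.
  - by rewrite -cardE cardC1 card_Fp.
  - apply/allP => x; rewrite mem_enum inE /= => x0; apply/unity_rootP.
    by apply: (mulfI x0); rewrite -exprS prednK ?prime_gt0 // mulr1 -{2}(expf_card x) card_Fp.
  - exact: enum_uniq.
(* As 4 divides p - 1, a power of the generator [w] has order 4; its square is a root of 1 other
   than 1, hence -1. *)
have i_prim := dvdn_prim_root w_prim dvd4.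
set i := w ^+ _ in i_prim.
have i2 : i ^+ 2 = -1.
  have : (i ^+ 2 - 1) * (i ^+ 2 + 1) = 0.
    by rewrite -subr_sqr expr1n -exprM (prim_expr_order i_prim) subrr.
  move/eqP; rewrite mulf_eq0 subr_eq0 -(prim_order_dvd i_prim) /=.
  by rewrite addr_eq0 => /eqP.
exists i; rewrite (dvdn_pcharf (pchar_Fp p_pr)) natrD natrX.
by rewrite natr_Zp i2 addNr.
Qed.

(* Newton's iteration x |-> x (3 + x^2) / 2 squares the error x^2 + 1 without
   inverting x. *)
Lemma exists_sqr_eqN1 p r : prime p -> p = 1 %[mod 4] -> (0 < r)%N ->
  exists x : 'Z_(p ^ r), x ^+ 2 = -1.
Proof.
move=> p_pr p1 r_gt0.
have n_gt1 : (1 < p ^ r)%N by rewrite -{1}(exp1n r) ltn_exp2r // prime_gt1.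
have newton (S : comNzRingType) (h q c x : S) k : 2 * h = 1 ->
    x ^+ 2 + 1 = q ^+ k.+1 * c ->
    exists y d, y ^+ 2 + 1 = q ^+ k.+2 * d.
  move=> h2 e; exists (x * (3 + x ^+ 2) * h).
  (* For the new point [y], [4 (y^2 + 1) = (x^2 + 1)^2 (x^2 + 4)]. Only one of the gained factors
     [q] is kept; the others go into the witness. *)
  exists (q ^+ k * c ^+ 2 * (x ^+ 2 + 4) * h ^+ 2).
  have -> : q ^+ k.+2 * (q ^+ k * c ^+ 2 * (x ^+ 2 + 4) * h ^+ 2) =
      (q ^+ k.+1 * c) ^+ 2 * (x ^+ 2 + 4) * h ^+ 2 by rewrite !exprS; ring.
  rewrite -e; transitivity ((x * (3 + x ^+ 2) * h) ^+ 2 + (2 * h) ^+ 2); last by ring.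
  by rewrite h2 expr1n.
have u2 : (2 : 'Z_(p ^ r)) \is a GRing.unit.
  rewrite unitZpE // coprimeXl // coprimen2.
  by move: p1; lia.
have lift k : exists x d : 'Z_(p ^ r), x ^+ 2 + 1 = p%:R ^+ k.+1 * d.
  elim: k => [|k [x [c e]]]; last exact: newton (mulrV u2) e.
  have [x /dvdnP[c e]] := exists_sqr_eqN1_mod_prime p_pr p1.
  by exists x%:R, c%:R; rewrite -natrX natr1 -addn1 e expr1 mulrC natrM.
have [x [d]] := lift r.-1; rewrite prednK // -natrX pchar_Zp // mul0r => e.
by exists x; apply/eqP; rewrite -addr_eq0 e.
Qed.

(** * Rotation matrices over a commutative ring *)

Section Rotations.

Variable S : comUnitRingType.
Implicit Types a b c d t : S.

Lemma rotmx_mul a b c d :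
  rotmx a b *m rotmx c d = rotmx (a * c - b * d) (a * d + b * c).
Proof.
apply/matrixP => i j; rewrite !mxE big_ord_recl big_ord1 !mxE.
by case: i j => [[|[|//]] ?] [[|[|//]] ?] /=; ring.
Qed.

Lemma rotmx_sub a b c d : rotmx a b - rotmx c d = rotmx (a - c) (b - d).
Proof.
apply/matrixP => i j; rewrite !mxE.
by case: i j => [[|[|//]] ?] [[|[|//]] ?] /=; ring.
Qed.

Lemma rotmx_scalar a : rotmx a 0 = a%:M.
Proof.
apply/matrixP => i j; rewrite !mxE.
by case: i j => [[|[|//]] ?] [[|[|//]] ?] //=; rewrite oppr0.
Qed.

(** Multiplying by the adjugate [rotmx a (- b)] leaves the scalar [a ^+ 2 + b ^+ 2], which is
    invertible. *)
Lemma mulmx_rotmx_eq0 k (M : 'M[S]_(k, 2)) a b :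
  a ^+ 2 + b ^+ 2 \is a GRing.unit -> M *m rotmx a b = 0 -> M = 0.
Proof.
move=> Uab M0; have : M *m rotmx a b *m rotmx a (- b) = 0 by rewrite M0 mul0mx.
rewrite -mulmxA rotmx_mul.
have -> : a * - b + b * a = 0 by ring.
rewrite rotmx_scalar mul_mx_scalar.
have -> : a * a - b * - b = a ^+ 2 + b ^+ 2 by ring.
move=> /(congr1 ( *:%R (a ^+ 2 + b ^+ 2)^-1)).
by rewrite scalerA mulVr // scale1r scaler0.
Qed.

Variables (i : S) (i2 : i ^+ 2 = -1) (U2 : (2 : S) \is a GRing.unit).

(* In an eigenbasis, [rotmx (rot_cos t) (rot_sin t)] acts as diag(t, t^-1). *)
Definition rot_cos t : S := (t + t^-1) / 2.
Definition rot_sin t : S := - i * (t - t^-1) / 2.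

Lemma rot_cos_sin t : t \is a GRing.unit -> rot_cos t ^+ 2 + rot_sin t ^+ 2 = 1.
Proof.
move=> Ut; have h2 := mulrV U2; have ts := mulrV Ut.
rewrite /rot_cos /rot_sin; set s := t^-1 in ts *; set h := 2^-1 in h2 *.
(* [ring] uses neither [i2] nor the inverses, so the expression is arranged to isolate [2 * h],
   [t * s] and [i ^+ 2 + 1]. *)
transitivity ((2 * h) ^+ 2 * (t * s) + (i ^+ 2 + 1) * (h * (t - s)) ^+ 2).
  by ring.
by rewrite h2 ts i2 addNr; ring.
Qed.

(** This is the determinant of the difference of two rotations. In the eigenbasis it is
    [(t - u) (t^-1 - u^-1)], which equals [- (t - u)^2 / (t u)]. *)
Lemma rot_cos_sin_sub t u :
  t \is a GRing.unit -> u \is a GRing.unit -> t - u \is a GRing.unit ->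
  (rot_cos t - rot_cos u) ^+ 2 + (rot_sin t - rot_sin u) ^+ 2 \is a GRing.unit.
Proof.
move=> Ut Uu Utu; have h2 := mulrV U2.
have -> : (rot_cos t - rot_cos u) ^+ 2 + (rot_sin t - rot_sin u) ^+ 2
   = (t - u) * (t^-1 - u^-1).
  rewrite /rot_cos /rot_sin; set s := t^-1; set v := u^-1; set h := 2^-1 in h2 *.
  transitivity ((2 * h) ^+ 2 * ((t - u) * (s - v))
     + (i ^+ 2 + 1) * (h * ((t - u) - (s - v))) ^+ 2); first by ring.
  by rewrite h2 i2 addNr; ring.
rewrite unitrMl //.
have -> : t^-1 - u^-1 = - (t^-1 * u^-1 * (t - u)).
  rewrite mulrBr mulrAC mulVr // mul1r -mulrA mulVr // mulr1; ring.
by rewrite unitrN unitrMl // unitrMl ?unitrV.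
Qed.

End Rotations.

(** * The group SO_2 and its action on frequencies *)

Lemma SO2P n (g : 'M['Z_n]_2) :
  reflect (exists a b, a ^+ 2 + b ^+ 2 = 1 /\ g = rotmx a b) (g \in SO2 n).
Proof.
apply: (iffP imsetP) => [[[a b]] | [a [b [ab ->]]]].
  by rewrite inE /= => /eqP ab ->; exists a, b.
by exists (a, b) => //; rewrite inE /= ab.
Qed.

Lemma SO2_mul n (g h : 'M['Z_n]_2) :
  g \in SO2 n -> h \in SO2 n -> g *m h \in SO2 n.
Proof.
move=> /SO2P[a [b [ab ->]]] /SO2P[c [d [cd ->]]]; apply/SO2P.
exists (a * c - b * d), (a * d + b * c); rewrite rotmx_mul; split=> //.
transitivity ((a ^+ 2 + b ^+ 2) * (c ^+ 2 + d ^+ 2)); first by ring.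
by rewrite ab cd mulr1.
Qed.

Lemma SO2_mulmx_eq0 n k (M : 'M['Z_n]_(k, 2)) g :
  g \in SO2 n -> M *m g = 0 -> M = 0.
Proof.
by move=> /SO2P[a [b [ab ->]]]; apply: mulmx_rotmx_eq0; rewrite ab unitr1.
Qed.

(* The rotations attached to t = 1, ..., p - 1 move every nonzero vector to
   p - 1 distinct places, because the differences of these t are units. *)
Lemma card_SO2_fibre_le p r : prime p -> p = 1 %[mod 4] -> (0 < r)%N ->
  forall xi eta : 'rV['Z_(p ^ r)]_2, xi != 0 ->
  (#|[set g in SO2 (p ^ r) | xi *m g == eta]| * p.-1 <= #|SO2 (p ^ r)|)%N.
Proof.
move=> p_pr p1 r_gt0 xi eta xi0; set n := (p ^ r)%N; set F := [set g in _ | _].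
have n_gt1 : (1 < n)%N by rewrite -{1}(exp1n r) ltn_exp2r // prime_gt1.
have [i i2] := exists_sqr_eqN1 p_pr p1 r_gt0.
have Unat k : (0 < k < p)%N -> (k%:R : 'Z_n) \is a GRing.unit.
  move=> /andP[k_gt0 k_lt]; rewrite unitZpE // coprimeXl // prime_coprime //.
  by rewrite gtnNdvd.
have U2 : (2 : 'Z_n) \is a GRing.unit.
  apply: Unat => /=; rewrite ltn_neqAle prime_gt1 // andbT.
  by apply/eqP => p2; move: p1; rewrite -p2.
pose t (j : 'I_p.-1) : 'Z_n := j.+1%:R.
have jP (j : 'I_p.-1) : (0 < j.+1 < p)%N by rewrite /= -ltn_predRL.
have Ut j : t j \is a GRing.unit by apply: Unat.
have Utt (j k : 'I_p.-1) : j != k -> t j - t k \is a GRing.unit.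
  rewrite -val_eqE neq_ltn => /orP[] lt_jk; last first.
    by rewrite /t -natrB ?ltnS 1?ltnW // Unat // subSS subn_gt0 lt_jk; have := jP j; lia.
  rewrite -unitrN opprB /t -natrB ?ltnS 1?ltnW // Unat // subSS subn_gt0 lt_jk.
  by have := jP k; lia.
pose h j := rotmx (rot_cos (t j)) (rot_sin i (t j)).
have hG j : h j \in SO2 n.
  by apply/SO2P; exists (rot_cos (t j)), (rot_sin i (t j)); rewrite rot_cos_sin.
(* [f] embeds [F] times [p.-1] indices into SO_2. A coincidence with [j != k] would give
   [eta *m (h j - h k) = 0], hence [eta = 0] and [xi = 0]. *)
pose f (u : 'M['Z_n]_2 * 'I_p.-1) := u.1 *m h u.2.
have f_inj : {in setX F setT &, injective f}.
  move=> [g j] [g' k]; rewrite !inE !andbT /= => /andP[gG /eqP ge] /andP[g'G /eqP g'e].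
  rewrite /f /= => egh.
  have ejk : j = k.
    apply/eqP; apply: contraNT xi0 => jk; apply/eqP.
    have: eta *m (h j - h k) = 0.
      by rewrite mulmxBr -{1}ge -g'e -!mulmxA egh subrr.
    rewrite rotmx_sub => /mulmx_rotmx_eq0 eta0.
    apply: (SO2_mulmx_eq0 gG); rewrite ge; apply: eta0.
    by apply: rot_cos_sin_sub => //; apply: Utt.
  rewrite -{k}ejk in egh *; congr (_, _); apply/eqP; rewrite -subr_eq0.
  by apply/eqP/(SO2_mulmx_eq0 (hG j)); rewrite mulmxBl egh subrr.
rewrite -[X in (_ * X)%N](card_ord p.-1) -cardsT -cardsX -(card_in_imset f_inj).
apply/subset_leq_card/subsetP => _ /imsetP[[g j] + ->].
by rewrite !inE !andbT => /andP[gG _]; apply: SO2_mul.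
Qed.

(** * Averaging over SO_2 and Markov's inequality *)

Lemma sum_SO2_collisions_le p r (A B : {set 'cV['Z_(p ^ r)]_2}) :
  prime p -> p = 1 %[mod 4] -> (0 < r)%N ->
  (2 * ((p ^ r) ^ 2) ^ 2 <= p * (#|A| * #|B|))%N ->
  ((p ^ r) ^ 2 * \sum_(g in SO2 (p ^ r)) #|collisions g A B| <=
     2 * (#|SO2 (p ^ r)| * (#|A| * #|B|) ^ 2))%N.
Proof.
move=> p_pr p1 r_gt0 dens; have p_gt1 := prime_gt1 p_pr.
have n_gt1 : (1 < p ^ r)%N by rewrite -{1}(exp1n r) ltn_exp2r.
have [z z_prim] := C_prim_root_exists (ltnW n_gt1).
have := sum_collisions_le n_gt1 z_prim A B (card_SO2_fibre_le p_pr p1 r_gt0).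
set N := #|_|; set E := (\sum_(g in _) _)%N; set Q := ((p ^ r) ^ 2)%N in dens *.
set m := (#|A| * #|B|)%N in dens * => main.
have p1_gt0 : (0 < p.-1)%N by lia.
rewrite -(leq_pmul2l p1_gt0); apply: leq_trans main _.
rewrite mul2n -addnn mulnDr leq_add2l.
rewrite (mulnCA p.-1) leq_mul2l -(mulnn m) mulnA leq_mul2r.
suff -> : (Q ^ 2 <= p.-1 * m)%N by rewrite !orbT.
(* The factor 2 in the density hypothesis pays for replacing [p] by [p.-1], since
   [p <= 2 * p.-1]. *)
rewrite -(leq_pmul2l (isT : (0 < 2)%N)); apply: leq_trans dens _.
by rewrite mulnA leq_mul2r; apply/orP; right; lia.
Qed.

Lemma half_SO2_large_rotdiff p r (A B : {set 'cV['Z_(p ^ r)]_2}) :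
  prime p -> p = 1 %[mod 4] -> (0 < r)%N ->
  (2 * ((p ^ r) ^ 2) ^ 2 <= p * (#|A| * #|B|))%N ->
  (#|SO2 (p ^ r)| <=
     2 * #|[set g in SO2 (p ^ r) | (p ^ r) ^ 2 <= 4 * #|rotdiff g A B|]|)%N.
Proof.
move=> p_pr p1 r_gt0 dens.
have := sum_SO2_collisions_le p_pr p1 r_gt0 dens.
have Q_gt0 : (0 < (p ^ r) ^ 2)%N by rewrite !expn_gt0 prime_gt0.
(* The density hypothesis excludes empty [A] or [B], so [m ^ 2] can be cancelled at the end. *)
have m_gt0 : (0 < (#|A| * #|B|) ^ 2)%N.
  rewrite expn_gt0 orbF lt0n; apply/eqP => m0; move: dens.
  by rewrite m0 muln0 leqn0 muln_eq0 /= expn_eq0 andbT -[_ == _]negbK -lt0n Q_gt0.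
set G := SO2 _; set m := (#|A| * #|B|)%N in m_gt0 *.
set good := [set g in _ | _] => main.
pose bad := G :\: good.
have cG : (#|G| = #|good| + #|bad|)%N.
  rewrite -(cardsID good G); congr (_ + _)%N; apply: eq_card => g.
  by rewrite !inE; case: (g \in G).
have cE g : (m ^ 2 <= #|rotdiff g A B| * #|collisions g A B|)%N.
  have -> : rotdiff g A B = (fun u => g *m u.1 - u.2) @: setX A B.
    by rewrite /rotdiff curry_imset2X; apply: eq_imset => -[].
  rewrite /m -cardsX; exact: card_sqr_le_collisions.
(* By Cauchy-Schwarz each bad [g] contributes at least [4 * m ^ 2] to a total of at most
   [2 * (#|G| * m ^ 2)]. *)
have : (4 * (#|bad| * m ^ 2) <= 2 * (#|G| * m ^ 2))%N.
  apply: leq_trans main; rewrite mulnCA -sum_nat_const big_distrr /=.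
  rewrite [leqRHS](big_setID good) /= -/bad; apply: leq_trans (leq_addl _ _).
  apply: leq_sum => g; rewrite !inE; case: (g \in G); rewrite ?andbF //= andbT.
  rewrite -ltnNge => small.
  apply: leq_trans (_ : 4 * (#|rotdiff g A B| * #|collisions g A B|) <= _)%N.
    by rewrite leq_mul2l cE.
  by rewrite mulnA leq_mul2r ltnW ?orbT.
by move: cG => ->; rewrite (mulnA 4) (mulnA 2) leq_pmul2r //; lia.
Qed.

Theorem theorem1p5 (R : realType) :
  exists c c' : R, 0 < c /\ 0 < c' /\
    forall (p r : nat), prime p -> p = 1 %[mod 4] -> (0 < r)%N ->
    forall A B : {set 'cV['Z_(p ^ r)]_2},
      2 * (p%:R)^-1 <= density R A * density R B ->
      c' * #|SO2 (p ^ r)|%:R <=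
        #|[set g in SO2 (p ^ r) | c * p%:R ^+ (2 * r) <= #|rotdiff g A B|%:R]|%:R.
Proof.
exists (4^-1), (2^-1); rewrite !invr_gt0 !ltr0n; split=> //; split=> //.
move=> p r p_pr p1 r_gt0 A B dens.
have p_gt0 : (0 < (p%:R : R)) by rewrite ltr0n prime_gt0.
have n_gt0 : 0 < (p ^ r)%:R :> R by rewrite natrX exprn_gt0.
rewrite mulrC ler_pdivrMr ?ltr0n // mulrC -natrM ler_nat.
have -> : [set g in SO2 (p ^ r) | 4^-1 * p%:R ^+ (2 * r) <= #|rotdiff g A B|%:R :> R]
  = [set g in SO2 (p ^ r) | ((p ^ r) ^ 2 <= 4 * #|rotdiff g A B|)%N].
  apply/setP => g; rewrite !inE; congr (_ && _).
  by rewrite mulrC ler_pdivrMr ?ltr0n // -natrX -natrM ler_nat mulnC expnM mulnC -!expnM mulnC.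
apply: half_SO2_large_rotdiff => //.
(* Clearing the denominators [p] and [(p ^ r) ^ 2], the latter twice, gives the integer form of the
   density hypothesis. *)
rewrite -(ler_nat R); move: dens; rewrite /density.
rewrite mulf_div ler_pdivlMr ?mulr_gt0 ?exprn_gt0 //.
rewrite mulrAC ler_pdivrMr //.
by rewrite !natrM !natrX -expr2 [_ * p%:R]mulrC.
Qed.
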